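(* Let $G$ be a finite noncyclic nilpotent group of order $n=p_1^{\alpha_1}p_2^{\alpha_2}\cdots p_r^{\alpha_r}$, where $p_1<p_2<\cdots<p_r$ are primes, $\alpha_i\geq 1$, and $r\geq 2$. For $i\in[r]$ let $P_i$ be the unique Sylow $p_i$-subgroup of $G$. Suppose that $2\phi\left(\prod_{i\in[r]}p_i\right)\geq \prod_{i\in[r]}p_i$. If $\delta(\mathcal{P}(G))=\deg(x)$ for some $x\in G$, then: (i) $x$ is contained in a unique element $M$ of $\mathcal{M}(G)$; (ii) there exist $i\in[r]$ and a generator $y$ of $M$ such that $x=y^{p_i^{\lambda_i}}$, where $|M\cap P_i|=p_i^{\gamma_i}$ and $\lambda_i\in\{0,1,\ldots,\gamma_i\}$ is the largest integer with the property that $M$ is the only element of $\mathcal{M}(G)$ containing $y^{p_i^{\lambda_i}}$.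
   Context: For a finite group $G$, the power graph $\mathcal{P}(G)$ is the simple graph with vertex set $G$ in which two distinct vertices are adjacent iff one is a positive power of the other. $\deg(v)$ denotes the degree of a vertex $v$ in $\mathcal{P}(G)$ and $\delta(\mathcal{P}(G))=\min_{v\in G}\deg(v)$ is the minimum degree. A cyclic subgroup of $G$ is maximal cyclic if it is not properly contained in any cyclic subgroup of $G$; $\mathcal{M}(G)$ denotes the set of maximal cyclic subgroups of $G$. $\phi$ is Euler's totient function and $[m]=\{1,\ldots,m\}$. *)

(* Defs.v *)
From HB Require Import structures.
From mathcomp Require Import all_boot all_order all_fingroup all_solvable.

Set Implicit Arguments.
Unset Strict Implicit.
Unset Printing Implicit Defensive.

Import GroupScope.

Section PowerGraph.

Variable gT : finGroupType.
Implicit Types (G M : {group gT}) (x y : gT).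

(* Exponents 1, ..., #[y] already give every positive power of y; see
   pos_powerP. *)
Definition pos_power x y : bool := [exists m : 'I_#[y], x == y ^+ m.+1].

Lemma pos_powerP x y :
  reflect (exists2 m : nat, 0 < m & x = y ^+ m) (pos_power x y).
Proof.
apply: (iffP existsP) => [[m /eqP ->]|[[|m] // _ ->]]; first by exists m.+1.
exists (Ordinal (ltn_pmod m (order_gt0 y))) => /=.
by rewrite !expgS -expg_mod_order.
Qed.

Definition power_adj x y : bool :=
  (x != y) && (pos_power x y || pos_power y x).

Definition power_deg G x : nat := #|[set y in G | power_adj x y]|.

Definition power_min_deg G : nat :=
  power_deg G [arg min_(v < 1 in G) power_deg G v].

Lemma power_min_deg_le G x : x \in G -> power_min_deg G <= power_deg G x.
Proof. by rewrite /power_min_deg; case: arg_minnP => // v _; apply. Qed.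

Lemma power_min_deg_attained G :
  exists2 x, x \in G & power_min_deg G = power_deg G x.
Proof.
by rewrite /power_min_deg; case: arg_minnP => // v Gv _; exists v.
Qed.

Definition max_cyclic G : {set {group gT}} :=
  [set M : {group gT} | [max M | (M \subset G) && cyclic M]].

Definition only_max_cyclic G x M : Prop :=
  unique (fun N : {group gT} => (N \in max_cyclic G) && (x \in N)) M.

End PowerGraph.

(* Main.v *)
Require Import Defs.
From mathcomp Require Import all_boot all_order all_fingroup all_solvable.

Import GroupScope.

(** Write [N[x]] for the closed neighbourhood of [x] in the power graph, so that
    [x] has minimum degree iff [N[x]] is smallest.  The hypothesis on the primes
    gives [k <= 2 phi(k)] for every [k] dividing [#|G|], since [phi(k) / k]
    decreases along divisibility and depends only on the primes dividing [k].

    If [x] lies in two maximal cyclic subgroups [M1], [M2], then [N[x]] contains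
    their generators and [1], hence has more than [min(|M1|, |M2|)] elements,
    while [N[y] = Mi] for a generator [y] of [Mi].

    So [x] lies in a unique [M], of order [m], and [N[x]] is contained in [M].
    If primes [q < p] both divide [m / #[x]], then
    [|N[y^p]| <= m/p + phi(m) < 1 + phi(m) + phi(m/p) + phi(m/q) <= |N[x]|]
    for a generator [y] of [M]. Hence [m / #[x]] is a power [p^a], and
    [x = y^(p^a)] for some generator [y]. If [M] were still the only maximal
    cyclic subgroup containing [x^p], then [N[x^p]] would be a proper subset of
    [N[x]], missing [x^q] for any other prime [q] dividing [m]; nilpotency
    makes [m] divisible by every prime divisor of [#|G|]. *)

(** * Totient inequalities along divisibility *)

Section Totient.

Local Open Scope nat_scope.

Lemma totient_primeM q k : prime q -> 0 < k ->
  totient (q * k) = (if q %| k then q else q.-1) * totient k.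
Proof.
move=> pr_q k_gt0; have [l co_ql Dk] := pfactor_coprime pr_q k_gt0.
case: ifPn => [q_k | q'k]; last first.
  by rewrite totient_coprime ?prime_coprime // totient_prime.
have a_gt0 : 0 < logn q k by rewrite logn_gt0 mem_primes pr_q k_gt0.
rewrite Dk mulnCA -expnS !totient_coprime ?coprimeXr 1?coprime_sym //.
rewrite !totient_pfactor // [RHS]mulnCA; congr (_ * _).
by rewrite [RHS]mulnCA -expnS prednK.
Qed.

Lemma totient_primeM_le q k : prime q -> totient (q * k) <= q * totient k.
Proof.
move=> pr_q; case: (posnP k) => [->|k_gt0]; first by rewrite !muln0.
rewrite totient_primeM // leq_mul2r.
by case: ifP; rewrite ?leqnn ?leq_pred orbT.
Qed.

Lemma totient_primeM_ge q k : prime q -> q.-1 * totient k <= totient (q * k).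
Proof.
move=> pr_q; case: (posnP k) => [->|k_gt0]; first by rewrite !muln0.
rewrite totient_primeM // leq_mul2r.
by case: ifP; rewrite ?leqnn ?leq_pred orbT.
Qed.

(** Strip the prime factors of [a] one at a time: each multiplies the totient by at most itself. *)
Lemma totientM_le a b : totient (a * b) <= a * totient b.
Proof.
elim/ltn_ind: a => [[|[|a]]] IH; rewrite ?mul0n ?mul1n //.
have [q pr_q /dvdnP[c Da]] := pdivP (isT : 1 < a.+2).
have lt_c : c < a.+2.
  rewrite Da ltn_Pmulr ?prime_gt1 //.
  by case: c Da => [|c] //; rewrite mul0n.
rewrite Da [c * q]mulnC -!mulnA (leq_trans (totient_primeM_le _ _ pr_q)) //.
by rewrite leq_mul2l IH ?orbT.
Qed.

Lemma totient_primesM a b : 0 < b ->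
  (forall q, prime q -> q %| a -> q %| b) -> totient (a * b) = a * totient b.
Proof.
move=> b_gt0; elim/ltn_ind: a => [[|[|a]]] IH ab; rewrite ?mul0n ?mul1n //.
have [q pr_q q_a] := pdivP (isT : 1 < a.+2).
have /dvdnP[c Da] := q_a.
have c_gt0 : 0 < c by case: c Da => [|c] //; rewrite mul0n.
have lt_c : c < a.+2 by rewrite Da ltn_Pmulr ?prime_gt1.
have q_b : q %| b by apply: ab.
rewrite Da [c * q]mulnC -!mulnA totient_primeM ?muln_gt0 ?c_gt0 //.
rewrite dvdn_mull // IH // => s pr_s s_c; apply: ab => //.
by rewrite Da dvdn_mulr.
Qed.

(** Write [n ^ e = c * k]. Then [n ^ e * totient n = totient (c * n * k) <= c * n * totient k];
    doubling, using [n <= 2 * totient n] and cancelling [c * n] gives the bound. *)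
Lemma totient_half_dvd n e k : 0 < n -> n <= 2 * totient n -> k %| n ^ e ->
  k <= 2 * totient k.
Proof.
move=> n_gt0 n_le /dvdnP[c Dn].
have ne_gt0 : 0 < n ^ e by rewrite expn_gt0 n_gt0.
have /andP[c_gt0 k_gt0] : (0 < c) && (0 < k) by rewrite -muln_gt0 -Dn.
have le1 : totient (n ^ e * n) <= c * n * totient k.
  by rewrite Dn mulnAC totientM_le.
rewrite totient_primesM // in le1; last first.
  by move=> q pr_q; rewrite Euclid_dvdX // => /andP[].
rewrite -(leq_pmul2l c_gt0) -Dn -(leq_pmul2r n_gt0).
apply: leq_trans (_ : n ^ e * (2 * totient n) <= _).
  by rewrite leq_mul2l n_le orbT.
by rewrite mulnCA [leqRHS]mulnAC [leqRHS]mulnCA leq_mul2l le1 orbT.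
Qed.

(** Both sides compare with multiples of [totient k], by [q] and [p.-1], and [q <= p.-1]. *)
Lemma leq_totient_swap p q k : prime p -> prime q -> q < p ->
  totient (q * k) <= totient (p * k).
Proof.
move=> pr_p pr_q lt_qp; apply: leq_trans (totient_primeM_le _ _ pr_q) _.
apply: leq_trans (totient_primeM_ge _ _ pr_p).
by rewrite leq_mul2r -ltnS prednK ?prime_gt0 // lt_qp orbT.
Qed.

End Totient.

(** * Closed neighbourhoods and maximal cyclic subgroups *)

Section PowerNeighbourhood.

Variable gT : finGroupType.
Implicit Types (G M N : {group gT}) (u v x y : gT).

Definition power_nbhd G x := [set u in G | (u \in <[x]>) || (x \in <[u]>)].

Lemma pos_power_cycle x y : pos_power x y = (x \in <[y]>).
Proof.
apply/pos_powerP/cycleP => [[m _ ->]|[m ->]]; first by exists m.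
(* Adding the order makes the exponent positive without changing the power. *)
exists (m + #[y])%N; first by rewrite addn_gt0 order_gt0 orbT.
by rewrite expgD expg_order mulg1.
Qed.

Lemma card_power_nbhd G x : x \in G -> #|power_nbhd G x| = (power_deg G x).+1.
Proof.
move=> Gx; rewrite (cardsD1 x) !inE Gx cycle_id add1n; congr _.+1.
apply: eq_card => u; rewrite !inE /power_adj !pos_power_cycle [u == x]eq_sym.
by rewrite andbCA; case: (x == u) => //=; rewrite orbC.
Qed.

(** Inside a cyclic group, adjacency thus becomes comparability of orders under divisibility. *)
Lemma mem_cycle_dvdn M u v : cyclic M -> u \in M -> v \in M ->
  (u \in <[v]>) = (#[u] %| #[v]).
Proof.
move=> cycM Mu Mv; rewrite -cycle_subG -(cardSg_cyclic cycM) ?cycle_subG //.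
Qed.

Lemma max_cyclic_ex G u : u \in G ->
  exists2 M : {group gT}, M \in max_cyclic G & u \in M.
Proof.
move=> Gu.
pose gP := [pred H : {group gT} | (H \subset G) && cyclic H].
have gPu : gP <[u]>%G.
  by rewrite /= cycle_subG Gu cycle_cyclic.
by have [M maxM suM] := maxgroup_exists gPu; exists M; rewrite ?inE -?cycle_subG.
Qed.

Lemma max_cyclic_props G M : M \in max_cyclic G ->
  [/\ M \subset G, cyclic M
    & forall u, u \in G -> M \subset <[u]> -> <[u]>%G = M].
Proof.
rewrite inE => /maxgroupP[/andP[sMG cycM] maxM]; split=> // u Gu sMu.
apply: val_inj => /=; apply: (maxM <[u]>%G) => //.
by rewrite cycle_subG Gu cycle_cyclic.
Qed.

Lemma power_nbhd_generator G M y :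
  M \in max_cyclic G -> generator M y -> power_nbhd G y = M.
Proof.
move=> maxM /eqP Dy; have [sMG cycM topM] := max_cyclic_props _ _ maxM.
apply/setP=> u; rewrite inE -Dy.
case: (boolP (u \in M)) => [Mu | M'u].
  by rewrite (subsetP sMG).
apply/andP=> -[Gu]; rewrite /= -cycle_subG -Dy => sMu.
by case/negP: M'u; rewrite -(topM u) ?cycle_id.
Qed.

Lemma generator_power_nbhd G M x u : M \subset G -> x \in M ->
  generator M u -> u \in power_nbhd G x.
Proof.
move=> sMG Mx /eqP Du; rewrite inE -Du Mx orbT andbT (subsetP sMG) // Du.
exact: cycle_id.
Qed.

Lemma card_generators M : cyclic M -> #|[set u | generator M u]| = totient #|M|.
Proof. by case/cyclicP=> y ->; rewrite totient_gen. Qed.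

Lemma two_max_cyclic_nbhd G M N x :
  (forall k, k %| #|G| -> k <= 2 * totient k)%N ->
  M \in max_cyclic G -> N \in max_cyclic G -> M != N -> x \in M -> x \in N ->
  exists2 u, u \in G & #|power_nbhd G u| < #|power_nbhd G x|.
Proof.
move=> half_G; wlog leMN : M N / #|M| <= #|N| => [IH|] maxM maxN neMN Mx Nx.
  case/orP: (leq_total #|M| #|N|) => [/IH|/IH]; first exact.
  by apply; rewrite // eq_sym.
have [sMG cycM topM] := max_cyclic_props _ _ maxM.
have [sNG cycN topN] := max_cyclic_props _ _ maxN.
have /cyclicP[y Dy] := cycM.
have gen_y : generator M y by rewrite /generator Dy.
have Gy : y \in G by rewrite -cycle_subG -Dy.
exists y => //; rewrite (power_nbhd_generator _ _ _ maxM gen_y).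
pose A := [set u | generator M u]; pose B := [set u | generator N u].
have disAB : A :&: B = set0.
  apply/setP=> u; rewrite !inE /generator; apply/andP=> -[/eqP Mu /eqP Nu].
  by case/eqP: neMN; apply: val_inj; rewrite /= Mu Nu.
(* If 1 generated [K], then [K] would be trivial, hence inside [L], and equal to it by
   maximality. *)
have not1 K L : K \in max_cyclic G -> L \in max_cyclic G -> K != L ->
    ~~ generator K 1.
  move=> /max_cyclic_props[_ _ topK] /max_cyclic_props[sLG /cyclicP[z Dz] _].
  move=> neKL.
  apply: contra neKL => /eqP DK; rewrite -(topK z) ?DK ?cycle1 ?sub1G //.
    by apply/eqP; apply: val_inj.
  by rewrite -cycle_subG -Dz.
have sub : 1 |: (A :|: B) \subset power_nbhd G x.
  apply/subsetP=> u; rewrite !inE => /or3P[/eqP->| gen_u | gen_u].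
  - by rewrite !group1.
  - by have := generator_power_nbhd _ _ _ _ sMG Mx gen_u; rewrite inE.
  - by have := generator_power_nbhd _ _ _ _ sNG Nx gen_u; rewrite inE.
apply: leq_trans (subset_leq_card sub).
rewrite cardsU1 !inE negb_or (not1 M N) // (not1 N M) 1?eq_sym //=.
rewrite cardsU disAB cards0 subn0 !card_generators // ltnS.
(* After doubling, one copy of [#|M|] is bounded through [M], the other through the larger [N]. *)
rewrite -(leq_pmul2l (isT : 0 < 2)) mulnDr mul2n -addnn.
by rewrite leq_add ?half_G ?cardSg // (leq_trans leMN) ?half_G ?cardSg.
Qed.

(** A maximal cyclic subgroup containing [u] also contains its power [x]. *)
Lemma only_max_cyclic_cycle G M u x : u \in G -> only_max_cyclic G x M ->
  x \in <[u]> -> only_max_cyclic G u M.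
Proof.
move=> Gu [_ uniM] x_u; have sub (K : {group gT}) : u \in K -> x \in K.
  by rewrite -cycle_subG => /subsetP; apply.
have [K maxK Ku] := max_cyclic_ex _ _ Gu.
have DM : M = K by apply: uniM; rewrite maxK sub.
by split=> [|L /andP[maxL Lu]]; [rewrite DM maxK | apply: uniM; rewrite maxL sub].
Qed.

Lemma power_nbhd_only G M x u : only_max_cyclic G x M ->
  (u \in power_nbhd G x) = (u \in M) && ((#[u] %| #[x]) || (#[x] %| #[u])).
Proof.
move=> only_x; have [/andP[maxM Mx] _] := only_x.
have [sMG cycM _] := max_cyclic_props _ _ maxM.
have [Mu | M'u] := boolP (u \in M); rewrite inE.
  by rewrite (subsetP sMG) // !(mem_cycle_dvdn M).
apply: contraNF M'u => /andP[Gu /orP[|x_u]].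
  by apply/subsetP; rewrite cycle_subG.
by have [/andP[]] := only_max_cyclic_cycle _ _ _ _ Gu only_x x_u.
Qed.

Lemma card_order_cyclic M k : cyclic M -> k %| #|M| ->
  #|[set u in M | #[u] == k]| = totient k.
Proof.
move=> cycM k_M; have /cyclicP[y Dy] := cycM.
have oy : #[y] = #|M| by rewrite Dy.
have oyk : #[y ^+ (#|M| %/ k)] = k.
  by rewrite orderXdiv oy ?dvdn_div // divnA // mulKn // cardG_gt0.
rewrite -[in RHS]oyk totient_gen; apply: eq_card => u; rewrite !inE.
have My : y ^+ (#|M| %/ k) \in M by rewrite Dy mem_cycle.
apply/andP/idP => [[Mu /eqP ou] | gen_u].
  by rewrite /generator (eq_subG_cyclic cycM) ?cycle_subG // -!orderE ou oyk.
rewrite -(generator_order gen_u) oyk eqxx; split=> //.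
by apply/subsetP: (cycle_generator gen_u); rewrite cycle_subG.
Qed.

Lemma two_primes_nbhd G M x p q :
  (forall k, k %| #|G| -> k <= 2 * totient k)%N ->
  only_max_cyclic G x M -> prime p -> prime q -> (q < p)%N ->
  (p * q * #[x])%N %| #|M| ->
  exists2 u, u \in G & #|power_nbhd G u| < #|power_nbhd G x|.
Proof.
move=> half_G only_x pr_p pr_q lt_qp /dvdnP[c Dm].
have [/andP[maxM Mx] _] := only_x.
have [sMG cycM _] := max_cyclic_props _ _ maxM.
have /cyclicP[y Dy] := cycM.
(* With [m = #|M|], [q * k] is [m / p] and [p * k] is [m / q]. *)
set k := (c * #[x])%N; have {}Dm : #|M| = (p * q * k)%N by rewrite Dm mulnCA.
have k_gt0 : 0 < k by have := cardG_gt0 M; rewrite Dm muln_gt0 => /andP[].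
have x_k : #[x] %| k by rewrite dvdn_mull.
clearbody k.
have oy : #[y ^+ p] = (q * k)%N.
  by rewrite orderXdiv orderE -Dy Dm -mulnA ?dvdn_mulr // mulKn ?prime_gt0.
have Myp : y ^+ p \in M by rewrite Dy mem_cycle.
have Gyp : y ^+ p \in G by apply: (subsetP sMG).
exists (y ^+ p) => //.
have only_y : only_max_cyclic G (y ^+ p) M.
  apply: (only_max_cyclic_cycle _ _ _ _ Gyp only_x).
  by rewrite (mem_cycle_dvdn M) // oy dvdn_mull.
pose E d := [set u in M | #[u] == d].
have cardE d : d %| #|M| -> #|E d| = totient d by apply: card_order_cyclic.
have disE d e : d != e -> E d :&: E e = set0.
  move=> ne_de; apply/setP=> u; rewrite !inE.
  by case: eqP => [->|]; rewrite ?(negPf ne_de) ?andbF.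
(* A neighbour having [y ^+ p] as a power has order a multiple of [m / p] dividing [m]; as [p] is
   prime, this is [m / p] or [m]. *)
have sub1 : power_nbhd G (y ^+ p) \subset <[y ^+ p]> :|: E #|M|.
  apply/subsetP=> u; rewrite (power_nbhd_only _ _ _ _ only_y) inE.
  case/andP=> Mu /orP[u_y | y_u]; first by rewrite (mem_cycle_dvdn M) // u_y.
  rewrite (mem_cycle_dvdn M) // [u \in E _]inE Mu /=.
  move: y_u (order_dvdG Mu); rewrite oy Dm => /dvdnP[a ->].
  rewrite -mulnA dvdn_pmul2r ?muln_gt0 ?k_gt0 ?prime_gt0 // => a_p.
  have /primeP[_ /(_ a a_p)/orP[/eqP-> | /eqP->]] := pr_p.
    by rewrite mul1n dvdnn.
  by rewrite eqxx orbT.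
have sub2 :
    1 |: (E #|M| :|: (E (q * k)%N :|: E (p * k)%N)) \subset power_nbhd G x.
  apply/subsetP=> u; rewrite (power_nbhd_only _ _ _ _ only_x) !inE.
  case/or4P=> [/eqP-> | | | ]; first by rewrite group1 order1 dvd1n.
  - by case/andP=> -> /eqP->; rewrite order_dvdG ?orbT.
  - by case/andP=> -> /eqP->; rewrite dvdn_mull ?orbT.
  - by case/andP=> -> /eqP->; rewrite dvdn_mull ?orbT.
apply: leq_trans (subset_leq_card sub2).
have p1 := prime_gt1 pr_p; have q1 := prime_gt1 pr_q.
have ne1 : (q * k != p * k)%N by rewrite eqn_pmul2r // neq_ltn lt_qp.
have ne2 : (p * q * k != q * k)%N.
  by rewrite eqn_pmul2r // -[X in _ != X]mul1n eqn_pmul2r 1?ltnW // gtn_eqF.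
have ne3 : (p * q * k != p * k)%N.
  by rewrite eqn_pmul2r // -[X in _ != X]muln1 eqn_pmul2l 1?ltnW // gtn_eqF.
have not1 : 1 \notin E #|M| :|: (E (q * k)%N :|: E (p * k)%N).
  rewrite !inE order1 group1 /= Dm; apply/negP.
  have ltk s : (1 < s -> 1 == s * k -> False)%N.
    by move=> s1 /eqP Es; move: s1; rewrite ltnNge Es leq_pmulr.
  by case/or3P; apply: ltk; rewrite // (leq_trans p1) // leq_pmulr // ltnW.
rewrite cardsU1 not1 cardsU setIUr !disE ?Dm // setU0 cards0 subn0.
rewrite cardsU disE // cards0 subn0 add1n ltnS -Dm.
have qk_M : (q * k)%N %| #|M| by rewrite Dm -mulnA dvdn_mull.
have pk_M : (p * k)%N %| #|M| by rewrite Dm mulnAC dvdn_mulr.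
rewrite !cardE //.
apply: leq_trans (subset_leq_card sub1) _.
apply: leq_trans (leq_card_setU _ _) _.
rewrite cardE // addnC leq_add2l -orderE oy.
have qk_G : (q * k)%N %| #|G| by rewrite -oy order_dvdG.
(* One of the two copies of [totient (q * k)] is traded for [totient (p * k)], as [q < p]. *)
apply: leq_trans (half_G _ qk_G) _.
by rewrite mul2n -addnn leq_add2l leq_totient_swap.
Qed.

(** For any generator [z] of [M], [x] and [z ^+ (p ^ a)] generate the same subgroup. The exponent
    relating them is prime to [#[x]], and must be made prime to [p] before it can be moved onto
    [z]. *)
Lemma prime_power_root M x p a : cyclic M -> x \in M -> prime p ->
  #|M| = (p ^ a * #[x])%N ->
  exists2 y, generator M y & x = y ^+ (p ^ a).
Proof.
move=> cycM Mx pr_p oM; have /cyclicP[z Dz] := cycM.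
have oz : #[z] = (p ^ a * #[x])%N by rewrite orderE -Dz.
have pa_gt0 : 0 < p ^ a by rewrite expn_gt0 prime_gt0.
have oza : #[z ^+ (p ^ a)] = #[x] by rewrite orderXdiv oz ?dvdn_mulr // mulKn.
have : x \in <[z ^+ (p ^ a)]> by rewrite (mem_cycle_dvdn M) ?oza // Dz mem_cycle.
case/cycleP=> s Dx.
have co_s : coprime #[x] s.
  rewrite -{1}oza -generator_coprime -Dx /generator (eq_subG_cyclic cycM).
  - by rewrite -!orderE oza.
  - by rewrite cycle_subG Dz mem_cycle.
  - by rewrite cycle_subG.
(* Shifting s by the order of x leaves x unchanged and makes s prime to p. *)
pose t := if p %| s then (s + #[x])%N else s.
have [co_pt co_xt Dxt] :
    [/\ coprime p t, coprime #[x] t & x = (z ^+ (p ^ a)) ^+ t].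
  rewrite /t; case: ifPn => [p_s | p's]; last by rewrite prime_coprime.
  split; last by rewrite expgD -oza expg_order mulg1.
    rewrite prime_coprime // dvdn_addr //; apply/negP=> p_x.
    have : p %| gcdn #[x] s by rewrite dvdn_gcd p_x.
    by rewrite (eqP co_s) dvdn1 gtn_eqF // prime_gt1.
  by rewrite /coprime gcdnDr.
exists (z ^+ t); last by rewrite Dxt -!expgM mulnC.
by rewrite Dz generator_coprime oz coprimeMl co_xt andbT coprimeXl.
Qed.

(** Otherwise an element of order [p] commutes with a generator of [M], by nilpotency and
    coprimality, and their product generates a larger cyclic subgroup. *)
Lemma primes_max_cyclic G M p : nilpotent G -> M \in max_cyclic G ->
  prime p -> p %| #|G| -> p %| #|M|.
Proof.
move=> nilG maxM pr_p p_G; have [sMG cycM topM] := max_cyclic_props _ _ maxM.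
apply: contraT => p'M; have [z Gz oz] := Cauchy pr_p p_G.
have /cyclicP[y Dy] := cycM.
have sz : <[z]> \subset G by rewrite cycle_subG.
have Gy : y \in G by rewrite -cycle_subG -Dy.
have co_yz : coprime #[y] #[z].
  by rewrite oz coprime_sym prime_coprime // orderE -Dy.
have cyz : commute y z.
  have := sub_nilpotent_cent2 nilG sMG sz; rewrite Dy => /(_ co_yz).
  by rewrite cycle_subG /= cent_cycle => /cent1P.
have Dyz := topM (y * z) (groupM Gy Gz).
have sM : M \subset <[y * z]> by rewrite cycleM // Dy mulG_subl.
have oM : #|M| = (#[y] * #[z])%N by rewrite -orderM // -(Dyz sM).
by move: p'M; rewrite oM oz dvdn_mull.
Qed.

Lemma power_nbhd_shrink G M y p q a : M \in max_cyclic G -> generator M y ->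
  prime p -> prime q -> p != q -> q %| #|M| -> (p ^ a.+1)%N %| #|M| ->
  only_max_cyclic G (y ^+ (p ^ a.+1)) M ->
  #|power_nbhd G (y ^+ (p ^ a.+1))| < #|power_nbhd G (y ^+ (p ^ a))|.
Proof.
move=> maxM /eqP Dy pr_p pr_q ne_pq q_M pa_M only1.
have [sMG cycM _] := max_cyclic_props _ _ maxM.
have Mexp j : y ^+ j \in M by rewrite Dy mem_cycle.
have only0 : only_max_cyclic G (y ^+ (p ^ a)) M.
  apply: (only_max_cyclic_cycle _ _ _ _ _ only1); first exact: (subsetP sMG).
  by rewrite expnS mulnC expgM mem_cycle.
have oy : #[y] = #|M| by rewrite orderE -Dy.
have pos j : 0 < p ^ j by rewrite expn_gt0 prime_gt0.
have co_pq : coprime q (p ^ a.+1).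
  by rewrite coprimeXr // prime_coprime // dvdn_prime2 // eq_sym.
have : (q * p ^ a.+1)%N %| #|M| by rewrite Gauss_dvd // q_M.
case/dvdnP=> n Dm.
have n_gt0 : 0 < n by have := cardG_gt0 M; rewrite Dm muln_gt0 => /andP[].
have o1 : #[y ^+ (p ^ a.+1)] = (n * q)%N.
  by rewrite orderXdiv oy // Dm mulnA mulnK.
have DM : #|M| = (n * q * p * p ^ a)%N by rewrite Dm expnS !mulnA.
have o0 : #[y ^+ (p ^ a)] = (n * q * p)%N.
  by rewrite orderXdiv oy DM ?dvdn_mull // mulnK.
apply/proper_card/properP; split.
  apply/subsetP=> u; rewrite !(power_nbhd_only _ M) // o0 o1.
  case/andP=> Mu /orP[u_n | n_u]; rewrite Mu /=; first by rewrite dvdn_mulr.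
  have := order_dvdG Mu; have /dvdnP[b ->] := n_u; rewrite DM.
  (* The cofactor [b] divides a power of [p]: if it is 1, [#[u]] divides [n * q * p]; otherwise
     [n * q * p] divides [#[u]]. *)
  rewrite [(b * _)%N]mulnC -[X in _ %| X]mulnA.
  rewrite !(dvdn_pmul2l (_ : 0 < n * q)%N) ?muln_gt0 ?n_gt0 ?prime_gt0 //.
  rewrite -expnS => /(dvdn_pfactor _ _ pr_p)[[|e] _ ->]; first by rewrite dvd1n.
  by rewrite expnS dvdn_mulr ?orbT.
have oq : #[y ^+ (p ^ a * q)] = (n * p)%N.
  have oy' : #[y] = (n * p * (p ^ a * q))%N.
    by rewrite oy DM [(n * q * p)%N]mulnAC -mulnA [(q * _)%N]mulnC.
  have dv : (p ^ a * q)%N %| #[y] by rewrite oy' dvdn_mull.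
  by rewrite (orderXdiv dv) oy' mulnK // muln_gt0 pos prime_gt0.
(* Its order [n * p] divides [n * q * p] but is incomparable with [n * q]. *)
exists (y ^+ (p ^ a * q)).
  by rewrite (power_nbhd_only _ M) // Mexp o0 oq mulnAC dvdn_mulr.
rewrite (power_nbhd_only _ M) // Mexp o1 oq /= !dvdn_pmul2l //.
by rewrite !dvdn_prime2 // [q == p]eq_sym orbb.
Qed.

End PowerNeighbourhood.

Arguments power_nbhd {gT} G x.

(** * Vertices of minimum degree *)

Theorem theorem1p1 (gT : finGroupType) (G : {group gT}) (r : nat)
    (p alpha : 'I_r -> nat) (P : 'I_r -> {group gT}) (x : gT)
    (nilG : nilpotent G) (ncycG : ~~ cyclic G)
    (r_ge2 : (2 <= r)%N)
    (p_prime : forall i : 'I_r, prime (p i))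
    (p_incr : forall i j : 'I_r, (i < j)%N -> (p i < p j)%N)
    (alpha_ge1 : forall i : 'I_r, (1 <= alpha i)%N)
    (oG : #|G| = (\prod_(i < r) p i ^ alpha i)%N)
    (sylP : forall i : 'I_r, (p i).-Sylow(G) (P i))
    (phi_ge : (\prod_(i < r) p i <= 2 * totient (\prod_(i < r) p i))%N)
    (Gx : x \in G) (deg_x : power_min_deg G = power_deg G x) :
  exists M : {group gT},
    only_max_cyclic G x M /\
    exists (i : 'I_r) (y : gT) (gamma lambda : nat),
      [/\ generator M y,
          #|M :&: P i| = (p i ^ gamma)%N,
          (lambda <= gamma)%N /\ only_max_cyclic G (y ^+ (p i ^ lambda)) M,
          forall k : nat, (k <= gamma)%N ->
            only_max_cyclic G (y ^+ (p i ^ k)) M -> (k <= lambda)%N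
        & x = y ^+ (p i ^ lambda)].
Proof.
set n := (\prod_(i < r) p i)%N in phi_ge.
have n_gt0 : 0 < n by apply: prodn_gt0 => i; apply: prime_gt0.
have half_G k : k %| #|G| -> (k <= 2 * totient k)%N.
  (* The largest exponent [alpha i] makes [#|G|] divide a power of [n]. *)
  move=> k_G; apply: (totient_half_dvd n (\max_i alpha i)) => //.
  apply: dvdn_trans k_G _; rewrite oG /n.
  rewrite (big_morph (fun m => m ^ _)%N (fun u v => expnMn u v _) (exp1n _)).
  apply: (big_ind2 (fun u v => u %| v)) => // [*|i _]; first exact: dvdn_mul.
  by apply: dvdn_exp2l; apply: leq_bigmax.
have p_G i : p i %| #|G|.
  by rewrite oG (bigD1 i) //= dvdn_mulr // dvdn_exp.
have min_x u : u \in G -> (#|power_nbhd G u| < #|power_nbhd G x|) = false.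
  move=> Gu; rewrite !card_power_nbhd // ltnS -deg_x ltnNge.
  by rewrite power_min_deg_le.
have [M maxM Mx] := max_cyclic_ex _ _ _ Gx.
have only_x : only_max_cyclic G x M.
  split=> [|N /andP[maxN Nx]]; first by rewrite maxM.
  apply/eqP; apply: contraT => neMN.
  have [u Gu] := two_max_cyclic_nbhd _ _ _ _ _ half_G maxM maxN neMN Mx Nx.
  by rewrite min_x.
exists M; split=> //.
have [sMG cycM _] := max_cyclic_props _ _ _ maxM.
have p_M i : p i %| #|M| by apply: (primes_max_cyclic _ _ _ _ nilG maxM).
have dvd_prime q : prime q -> q %| #|M| -> exists i, q = p i.
  move=> pr_q /dvdn_trans/(_ (cardSg sMG)); rewrite oG.
  rewrite (big_morph (fun m => q %| m) (fun u v => Euclid_dvdM u v pr_q)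
             (_ : _ = false)).
    rewrite big_has_cond => /hasP[i _ /=]; rewrite Euclid_dvdX // dvdn_prime2 //.
    by case/andP=> /eqP-> _; exists i.
  by rewrite dvdn1 gtn_eqF ?prime_gt1.
have [i [a oM]] : exists i a, #|M| = (p i ^ a * #[x])%N.
  have /dvdnP[d Dm] := order_dvdG Mx.
  have d_gt0 : 0 < d by have := cardG_gt0 M; rewrite Dm muln_gt0 => /andP[].
  have [d1 | d_gt1] := leqP d 1.
    (* Here [x] generates [M], so any prime serves, with exponent 0. *)
    exists (Ordinal (ltnW r_ge2)), 0; rewrite expn0 Dm.
    by have -> : d = 1%N by apply/eqP; rewrite eqn_leq d1.
  have [q pr_q q_d] := pdivP d_gt1.
  have [|i Dq] := dvd_prime q pr_q; first by rewrite Dm dvdn_mulr.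
  exists i, (logn (p i) d); rewrite Dm -Dq; congr (_ * _)%N.
  rewrite -p_part part_pnat_id //; apply/pnatP=> // s pr_s s_d.
  have two s1 s2 : prime s1 -> prime s2 -> s1 %| d -> s2 %| d ->
      (s2 < s1)%N = false.
    move=> pr1 pr2 s1_d s2_d; apply/negP=> lt21.
    have co12 : coprime s1 s2.
      by rewrite prime_coprime // dvdn_prime2 // gtn_eqF.
    have dv : (s1 * s2 * #[x])%N %| #|M|.
      by rewrite Dm dvdn_mul // Gauss_dvd // s1_d.
    have [u Gu] := two_primes_nbhd _ _ _ _ _ _ half_G only_x pr1 pr2 lt21 dv.
    by rewrite min_x.
  have := two _ _ pr_s pr_q s_d q_d; have := two _ _ pr_q pr_s q_d s_d.
  by rewrite inE /=; case: ltngtP.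
have [y gen_y Dx] := prime_power_root _ _ _ _ _ cycM Mx (p_prime i) oM.
exists i, y, (logn (p i) #|M|), a.
have dvd_gamma k : (k <= logn (p i) #|M|)%N -> (p i ^ k)%N %| #|M|.
  by rewrite -pfactor_dvdn.
split=> //.
(* Since [P i] is normal, its intersection with [M] is a Sylow subgroup of [M]. *)
- have nP : P i <| G by rewrite (nilpotent_Hall_pcore nilG (sylP i)) pcore_normal.
  have := setI_normal_Hall nP (sylP i) sMG; rewrite setIC => /card_Hall ->.
  by rewrite p_part.
- by rewrite -Dx; split=> //; rewrite -pfactor_dvdn // oM dvdn_mulr.
move=> k le_k only_k; rewrite leqNgt; apply/negP=> lt_ak.
(* Uniqueness at [k > a] passes down to [a.+1], since [y ^+ (p i ^ k)] is a power of
   [y ^+ (p i ^ a.+1)]. *)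
have only1 : only_max_cyclic G (y ^+ (p i ^ a.+1)) M.
  apply: (only_max_cyclic_cycle _ _ _ _ _ _ only_k).
    by apply: (subsetP sMG); rewrite (eqP gen_y) mem_cycle.
  by rewrite -(subnKC lt_ak) expnD expgM mem_cycle.
(* As [r >= 2], one of the first two primes differs from [p i]. *)
have [j ne_ij] : exists j, p i != p j.
  pose o0 : 'I_r := Ordinal (ltnW r_ge2); pose o1 : 'I_r := Ordinal r_ge2.
  have lt01 : (p o0 < p o1)%N by apply: p_incr.
  case: (eqVneq (p i) (p o0)) => [->|]; last by exists o0.
  by exists o1; rewrite neq_ltn lt01.
have := power_nbhd_shrink _ _ _ _ _ _ _ maxM gen_y (p_prime i) (p_prime j)
  ne_ij (p_M j) (dvd_gamma _ (leq_trans lt_ak le_k)) only1.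
rewrite -Dx min_x //.
by apply: (subsetP sMG); rewrite (eqP gen_y) mem_cycle.
Qed.
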